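(* Let $\ell\in(0,1]$, $\alpha\in(0,1]$, $\sigma=\sqrt\ell$, $\ell_\alpha=1-\alpha+\alpha\ell$. For $\theta\in(-\pi,\pi)$ let $z_\alpha(\theta)=1-\alpha+\alpha\sigma e^{\mathrm i\theta}$, $r_\alpha(\theta)=|z_\alpha(\theta)|$, and let $\varphi_\alpha(\theta)=\arg(z_\alpha(\theta))\in(-\pi,\pi)$ be the principal argument; at $\theta=\pi$ define $r_\alpha(\pi)$ and $\varphi_\alpha(\pi)$ by their left limits as $\theta\uparrow\pi$. Then, with $c_{m,n}$ as defined in the context, for all integers $0\le m\le n$, $$c_{m,n}=\ell_\alpha^{\,m}-\ell_\alpha^{\,n}+\frac{2\sigma}{\pi}\int_0^\pi\frac{r_\alpha(\theta)^{m+n}\sin\big((n-m)\varphi_\alpha(\theta)\big)\sin\theta}{1-2\sigma\cos\theta+\sigma^2}\,d\theta .$$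
   Context: For integers $0\le m\le n$, $$c_{m,n}=\alpha\sum_{j=0}^{n-1}\sum_{k=0}^{m}\left[\binom{m}{k}\binom{n-1-j}{k}-\binom{n}{k}\binom{m-1-j}{k}\right](\alpha^2\ell)^k(1-\alpha)^{n+m-1-j-2k},$$ with the convention $\binom{a}{k}=0$ unless $0\le k\le a$, and $0^0=1$; the inner sum is restricted to $k\le\min\{m,n-1-j\}$ (the bracket vanishes for larger $k$). When $\ell=1$ the integral is understood as a (convergent) improper integral at the origin. *)

(* Defs.v *)
From Stdlib Require Import Reals Lra Psatz ZArith List.
From Coquelicot Require Import Coquelicot.
Open Scope R_scope.

(* [sum_below N f] has exactly [N] terms, hence is [0] for [N = 0]
   (unlike [sum_f_R0] and [sum_n], which always have at least one). *)
Definition sum_below (N : nat) (f : nat -> R) : R :=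
  fold_right Rplus 0 (map f (seq 0 N)).

(* The upper index is an integer because [m - 1 - j] may be negative.  The guard
   is needed: [Binomial.C] is not [0] outside its natural range. *)
Definition binom (a : Z) (k : nat) : R :=
  if Z_le_dec (Z.of_nat k) a then Binomial.C (Z.to_nat a) k else 0.

(* In the range of summation, [j <= n - 1] and [k <= min m (n - 1 - j)], the
   natural subtractions in the exponent and in the bound of the inner sum do
   not truncate.  [x ^ 0 = 1] for every [x], including [x = 0]. *)
Definition coef (alpha ell : R) (m n : nat) : R :=
  alpha * sum_below n (fun j =>
    sum_f_R0 (fun k =>
      (binom (Z.of_nat m) k * binom (Z.of_nat n - 1 - Z.of_nat j) k
       - binom (Z.of_nat n) k * binom (Z.of_nat m - 1 - Z.of_nat j) k)
      * (alpha ^ 2 * ell) ^ k * (1 - alpha) ^ (n + m - 1 - j - 2 * k))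
    (Nat.min m (n - 1 - j))).

Definition cis (t : R) : C := (cos t, sin t).

Definition is_principal_arg (z : C) (t : R) : Prop :=
  - PI < t <= PI /\ z = (RtoC (Cmod z) * cis t)%C.

(* An unspecified real number at [z = 0]. *)
Definition Carg (z : C) : R :=
  iota (T := R_CompleteSpace) (is_principal_arg z).

Lemma is_principal_arg_unique (z : C) (s t : R) :
  z <> 0%C -> is_principal_arg z s -> is_principal_arg z t -> s = t.
Proof.
intros Hz [Hs Es] [Ht Et].
assert (Hc : RtoC (Cmod z) <> 0%C).
{ intros H. apply Hz, Cmod_eq_0. now injection H. }
assert (E : cis s = cis t).
{ rewrite <- (Cmult_1_l (cis s)), <- (Cmult_1_l (cis t)).
  rewrite <- (Cinv_l _ Hc), <- !Cmult_assoc. now rewrite <- Es, <- Et. }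
unfold cis in E. injection E as Ec Esn.
assert (H0 : forall x, - PI < x < 0 -> sin x < 0).
{ intros x Hx. apply sin_lt_0_var; lra. }
assert (H1 : forall x, 0 <= x <= PI -> 0 <= sin x).
{ intros x Hx. apply sin_ge_0; lra. }
destruct (Rlt_le_dec s 0) as [Ls|Ls]; destruct (Rlt_le_dec t 0) as [Lt|Lt].
- rewrite <- (cos_neg s), <- (cos_neg t) in Ec.
  assert (- s = - t); [|lra].
  rewrite <- (acos_cos (- s)), <- (acos_cos (- t)) by lra. now rewrite Ec.
- specialize (H0 s). specialize (H1 t). lra.
- specialize (H0 t). specialize (H1 s). lra.
- rewrite <- (acos_cos s), <- (acos_cos t) by lra. now rewrite Ec.
Qed.

Lemma is_principal_arg_exists (z : C) :
  z <> 0%C -> exists t, is_principal_arg z t.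
Proof.
intros Hz.
pose proof (proj1 (Cmod_gt_0 z) Hz) as Hr.
pose proof (Cmod2_alt z) as H2.
destruct z as [x y]. simpl Re in H2. simpl Im in H2.
set (r := Cmod (x, y)) in *.
set (u := x / r).
assert (Hx : x = r * u) by (unfold u; field; lra).
assert (Hq : u² + (y / r)² = 1).
{ replace (u² + (y / r)²) with ((x ^ 2 + y ^ 2) / r ^ 2)
    by (unfold u, Rsqr; field; lra).
  rewrite <- H2. field. lra. }
assert (Hu : -1 <= u <= 1) by (unfold Rsqr in Hq; split; nra).
pose proof (acos_bound u) as Hb.
assert (Hy : Rabs y = r * sqrt (1 - u²)).
{ replace (1 - u²) with ((y / r)²) by lra.
  rewrite sqrt_Rsqr_abs, Rabs_div, (Rabs_right r) by lra. field. lra. }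
destruct (Rle_lt_dec 0 y) as [Py|Py].
- exists (acos u). split; [pose proof PI_RGT_0; lra|].
  fold r. unfold cis. rewrite cos_acos, sin_acos by lra.
  rewrite Rabs_right in Hy by lra.
  unfold Cmult, RtoC; simpl. f_equal; lra.
- exists (- acos u). split.
  + split; [|pose proof PI_RGT_0; lra].
    destruct (Req_dec (acos u) PI) as [E|E]; [exfalso|lra].
    assert (E1 : u = -1) by (rewrite <- (cos_acos u), E by lra; apply cos_PI).
    rewrite E1 in Hy. replace (1 - (-1)²) with 0 in Hy by (unfold Rsqr; ring).
    rewrite sqrt_0, Rabs_left in Hy by lra. lra.
  + fold r. unfold cis. rewrite cos_neg, sin_neg, cos_acos, sin_acos by lra.
    rewrite Rabs_left in Hy by lra.
    unfold Cmult, RtoC; simpl. f_equal; lra.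
Qed.

Lemma Carg_correct (z : C) : z <> 0%C -> is_principal_arg z (Carg z).
Proof.
intros Hz. destruct (is_principal_arg_exists z Hz) as [t Ht].
change (is_principal_arg z
  (iota (T := R_CompleteNormedModule) (is_principal_arg z))).
apply iota_correct. exists t. split; [exact Ht|].
intros s Hs. now apply (is_principal_arg_unique z).
Qed.

Definition left_limit (f : R -> R) (a : R) : R :=
  iota (T := R_CompleteSpace) (fun l : R => filterlim f (at_left a) (locally l)).

Lemma left_limit_unique (f : R -> R) (a l : R) :
  filterlim f (at_left a) (locally l) -> left_limit f a = l.
Proof.
exact (iota_filterlim_locally (V := R_CompleteNormedModule) f l).
Qed.

Definition z_ (alpha sigma theta : R) : C :=
  (RtoC (1 - alpha) + RtoC (alpha * sigma) * cis theta)%C.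

Definition r_ (alpha sigma theta : R) : R :=
  if Req_dec_T theta PI
  then left_limit (fun t => Cmod (z_ alpha sigma t)) PI
  else Cmod (z_ alpha sigma theta).

Definition phi_ (alpha sigma theta : R) : R :=
  if Req_dec_T theta PI
  then left_limit (fun t => Carg (z_ alpha sigma t)) PI
  else Carg (z_ alpha sigma theta).

Definition integrand (alpha sigma : R) (m n : nat) (theta : R) : R :=
  r_ alpha sigma theta ^ (m + n)
  * sin ((INR n - INR m) * phi_ alpha sigma theta) * sin theta
  / (1 - 2 * sigma * cos theta + sigma ^ 2).

(* For [ell = 1] the denominator of the integrand vanishes at the origin. *)
Definition is_integral_0_PI (ell : R) (f : R -> R) (J : R) : Prop :=
  (ell < 1 -> is_RInt f 0 PI J) /\
  (ell = 1 -> is_RInt_gen f (at_right 0) (at_point PI) J).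

(* Main.v *)
(* Let A and B be independent binomial variables with parameters (n, alpha) and
   (m, alpha).  Summing over the trial at which A reaches k + 1 shows that
   coef = E[sgn(A - B) ell^min(A, B)].  On the other side, with
   x = sigma e^(i theta), we have z = 1 - alpha + alpha x, so that
   z^n conj(z)^m = E[x^A conj(x)^B], and
     int_0^pi sin(p t) sin t / (1 - 2 sigma cos t + sigma^2) dt
       = pi/2 sigma^(p - 1)   (p >= 1)
   turns the integral term into E[sgn(A - B) ell^max(A, B)].  It remains to note
   that sgn(A - B) (ell^min - ell^max) = ell^B - ell^A, and
   ell_alpha^n = E[ell^A]. *)
Require Import Defs.
From Stdlib Require Import Reals ZArith Arith List Lra Lia.
From Coquelicot Require Import Coquelicot.
Open Scope R_scope.

(** * Expectations under a binomial law *)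

(* The expectation of [g X] for [X] binomial with parameters [n] and [a]. *)
Fixpoint bexp (a : R) (n : nat) (g : nat -> R) : R :=
  match n with
  | O => g O
  | S n' => (1 - a) * bexp a n' g + a * bexp a n' (fun i => g (S i))
  end.

Lemma bexp_ext a n f g :
  (forall i, (i <= n)%nat -> f i = g i) -> bexp a n f = bexp a n g.
Proof.
revert f g; induction n as [|n IH]; intros f g H; simpl.
- apply H; lia.
- rewrite (IH f g), (IH (fun i => f (S i)) (fun i => g (S i))); trivial;
    intros; apply H; lia.
Qed.

Lemma bexp_const a n c : bexp a n (fun _ => c) = c.
Proof. induction n as [|n IH]; simpl; rewrite ?IH; ring. Qed.

Lemma bexp_plus a n f g :
  bexp a n (fun i => f i + g i) = bexp a n f + bexp a n g.
Proof.
revert f g; induction n as [|n IH]; intros f g; simpl; trivial.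
rewrite IH, (IH (fun i => f (S i))); ring.
Qed.

Lemma bexp_scal a n c f : bexp a n (fun i => c * f i) = c * bexp a n f.
Proof.
revert f; induction n as [|n IH]; intros f; simpl; trivial.
rewrite IH, (IH (fun i => f (S i))); ring.
Qed.

Lemma bexp_minus a n f g :
  bexp a n (fun i => f i - g i) = bexp a n f - bexp a n g.
Proof.
rewrite (bexp_ext _ _ _ (fun i => f i + (-1) * g i)) by (intros; ring).
rewrite bexp_plus, bexp_scal; ring.
Qed.

Lemma bexp_sum a n N (f : nat -> nat -> R) :
  bexp a n (fun i => sum_f_R0 (f i) N)
  = sum_f_R0 (fun k => bexp a n (fun i => f i k)) N.
Proof.
induction N as [|N IH]; simpl; trivial. now rewrite bexp_plus, IH.
Qed.

Lemma bexp_pow a n x : bexp a n (pow x) = (1 - a + a * x) ^ n.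
Proof.
induction n as [|n IH]; simpl; trivial.
change (fun i => x ^ S i) with (fun i => x * x ^ i).
rewrite bexp_scal. change (fun i => x ^ i) with (pow x). rewrite IH. ring.
Qed.

Lemma is_RInt_bexp a n (h : nat -> R -> R) (I : nat -> R) x y :
  (forall i, is_RInt (h i) x y (I i)) ->
  is_RInt (fun t => bexp a n (fun i => h i t)) x y (bexp a n I).
Proof.
revert h I; induction n as [|n IH]; intros h I H; simpl; [apply H|].
apply @is_RInt_plus; apply @is_RInt_scal; apply IH; intros; apply H.
Qed.

(** In the induction the free factor [w] absorbs one [x] per successful trial. It also allows two
    nested uses, on a power of [z_] and then on a power of its conjugate. *)
Lemma Im_bexp a n (x w : C) :
  Im ((RtoC (1 - a) + RtoC a * x) ^ n * w)%C
  = bexp a n (fun i => Im (x ^ i * w)%C).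
Proof.
revert w; induction n as [|n IH]; intros w; cbn [bexp]; trivial.
rewrite (bexp_ext _ _ (fun i => Im (x ^ S i * w)%C)
  (fun i => Im (x ^ i * (x * w))%C)).
2: { intros i _. f_equal. rewrite Cpow_S. ring. }
rewrite <- IH, <- IH, Cpow_S.
set (u := ((RtoC (1 - a) + RtoC a * x) ^ n)%C).
replace ((RtoC (1 - a) + RtoC a * x) * u * w)%C
  with (RtoC (1 - a) * (u * w) + RtoC a * (u * (x * w)))%C by ring.
rewrite im_plus, !im_scal_l. ring.
Qed.

(** * Binomial masses *)

Definition ind (b : bool) : R := if b then 1 else 0.

(* [P(X = k)] for [X] binomial with parameters [i] and [a], and [0] for [i < 0]. *)
Definition bmass (a : R) (i : Z) (k : nat) : R :=
  binom i k * a ^ k * (1 - a) ^ (Z.to_nat i - k).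

Lemma binom_nat (n k : nat) :
  binom (Z.of_nat n) k = if le_dec k n then Binomial.C n k else 0.
Proof.
unfold binom. rewrite Nat2Z.id.
destruct (Z_le_dec (Z.of_nat k) (Z.of_nat n)), (le_dec k n); trivial; lia.
Qed.

Lemma binom_out (i : Z) k : (i < Z.of_nat k)%Z -> binom i k = 0.
Proof. intros H. unfold binom. destruct (Z_le_dec (Z.of_nat k) i); trivial; lia. Qed.

Lemma binom_pascal (n k : nat) :
  binom (Z.of_nat (S n)) (S k) = binom (Z.of_nat n) k + binom (Z.of_nat n) (S k).
Proof.
rewrite !binom_nat.
destruct (lt_eq_lt_dec k n) as [[H|H]|H].
- destruct (le_dec (S k) (S n)), (le_dec k n), (le_dec (S k) n); try lia.
  now rewrite pascal.
- subst. destruct (le_dec (S n) (S n)), (le_dec n n), (le_dec (S n) n); try lia.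
  rewrite !C_n_n; ring.
- destruct (le_dec (S k) (S n)), (le_dec k n), (le_dec (S k) n); try lia; ring.
Qed.

Lemma binom_0_r (n : nat) : binom (Z.of_nat n) 0 = 1.
Proof. rewrite binom_nat. apply C_n_0. Qed.

Lemma bexp_ind_eq a n k :
  bexp a n (fun i => ind (Nat.eqb i k)) = bmass a (Z.of_nat n) k.
Proof.
unfold bmass. rewrite Nat2Z.id.
revert k; induction n as [|n IH]; intros [|k]; simpl bexp.
- rewrite binom_0_r. simpl. ring.
- rewrite binom_out by lia. simpl. ring.
- rewrite IH, bexp_const, !binom_0_r, !Nat.sub_0_r. simpl. ring.
- rewrite IH, IH, binom_pascal.
  (* If [k >= n], the mass at [S k] vanishes, so the truncated exponent [n - S k] does no harm. *)
  destruct (le_dec (S k) n) as [H|H].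
  + replace (S n - S k)%nat with (S (n - S k)) by lia.
    replace (n - k)%nat with (S (n - S k)) by lia. simpl. ring.
  + rewrite (binom_out (Z.of_nat n) (S k)) by lia.
    replace (S n - S k)%nat with (n - k)%nat by lia. simpl. ring.
Qed.

(** * Finite sums and binomial tails *)

Lemma sum_below_S N f :
  sum_below (S N) f = f O + sum_below N (fun j => f (S j)).
Proof.
unfold sum_below. change (seq 0 (S N)) with (0%nat :: seq 1 N).
now rewrite <- seq_shift, map_cons, map_map.
Qed.

Lemma sum_below_ext N f g :
  (forall j, (j < N)%nat -> f j = g j) -> sum_below N f = sum_below N g.
Proof.
revert f g; induction N as [|N IH]; intros f g H; trivial.
rewrite !sum_below_S. f_equal; [apply H; lia|].
apply IH; intros; apply H; lia.
Qed.

Lemma sum_below_minus N f g :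
  sum_below N (fun j => f j - g j) = sum_below N f - sum_below N g.
Proof.
revert f g; induction N as [|N IH]; intros f g; [unfold sum_below; simpl; ring|].
rewrite !sum_below_S, IH; ring.
Qed.

Lemma sum_below_scal N c f :
  sum_below N (fun j => c * f j) = c * sum_below N f.
Proof.
revert f; induction N as [|N IH]; intros f; [unfold sum_below; simpl; ring|].
rewrite !sum_below_S, IH; ring.
Qed.

Lemma sum_below_sum_f_R0 N M (f : nat -> nat -> R) :
  sum_below N (fun j => sum_f_R0 (f j) M)
  = sum_f_R0 (fun k => sum_below N (fun j => f j k)) M.
Proof.
induction M as [|M IH]; simpl; trivial.
rewrite <- IH.
rewrite (sum_below_ext _ _ (fun j => sum_f_R0 (f j) M - (-1) * f j (S M)))
  by (intros; ring).
rewrite sum_below_minus, sum_below_scal; ring.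
Qed.

(* [X > k] means that success number [k + 1] occurs at some trial, and if that
   is trial [i + 1] then exactly [k] of the first [i] trials succeed; here
   [i = m - 1 - j]. *)
Lemma bexp_ind_lt a m n k : (m <= n)%nat ->
  bexp a m (fun i => ind (Nat.ltb k i))
  = a * sum_below n (fun j => bmass a (Z.of_nat m - 1 - Z.of_nat j) k).
Proof.
revert m; induction n as [|n IH]; intros [|m] H.
- unfold sum_below; simpl. ring.
- lia.
(* With no trials every index is negative and every mass is zero; the form [0 * 0] lets
   [sum_below_scal] extract a factor [0]. *)
- rewrite (sum_below_ext _ _ (fun _ => 0 * 0)), sum_below_scal; [simpl; ring|].
  intros j _. unfold bmass. rewrite binom_out by lia. ring.
- rewrite sum_below_S.
  rewrite (sum_below_ext _ _
    (fun j => bmass a (Z.of_nat m - 1 - Z.of_nat j) k))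
    by (intros; f_equal; lia).
  rewrite Rmult_plus_distr_l, <- IH by lia.
  replace (Z.of_nat (S m) - 1 - Z.of_nat 0)%Z with (Z.of_nat m) by lia.
  rewrite <- bexp_ind_eq. simpl.
  rewrite (bexp_ext a m (fun i => ind (Nat.ltb k (S i)))
    (fun i => ind (Nat.ltb k i) + ind (Nat.eqb i k))).
  + rewrite bexp_plus. ring.
  + intros i _. destruct (Nat.ltb_spec k (S i)), (Nat.ltb_spec k i),
      (Nat.eqb_spec i k); simpl; try lia; ring.
Qed.

(** * The coefficient as an expectation *)

(* [sgn(i - j) l ^ min(i, j)] *)
Definition signed_min (l : R) (i j : nat) : R :=
  if Nat.ltb j i then l ^ j else if Nat.ltb i j then - l ^ i else 0.

Lemma sum_f_R0_single (f : nat -> R) p N :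
  (p <= N)%nat -> (forall k, k <> p -> f k = 0) -> sum_f_R0 f N = f p.
Proof.
intros Hp H.
assert (H0 : forall M, (M < p)%nat -> sum_f_R0 f M = 0).
{ induction M as [|M IH]; intros HM; simpl; [apply H; lia|].
  rewrite IH, H by lia; ring. }
induction N as [|N IH]; simpl.
- f_equal; lia.
- destruct (Nat.eq_dec p (S N)) as [->|E].
  + rewrite H0 by lia; ring.
  + rewrite IH, (H (S N)) by lia; ring.
Qed.

Lemma sum_f_R0_extend (f : nat -> R) N M :
  (N <= M)%nat -> (forall k, (N < k <= M)%nat -> f k = 0) ->
  sum_f_R0 f N = sum_f_R0 f M.
Proof.
intros H; induction H as [|M H IH]; intros H0; trivial.
simpl. rewrite H0, IH by lia || (intros; apply H0; lia). ring.
Qed.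

(** Only [k = min(i, j)] contributes, and [j <= N] keeps it in range. Each term is a product of a
    function of [i] and a function of [j], so expectations over independent variables factor. *)
Lemma signed_min_sum l i j N : (j <= N)%nat ->
  signed_min l i j
  = sum_f_R0 (fun k => l ^ k * (ind (Nat.eqb j k) * ind (Nat.ltb k i)
      - ind (Nat.eqb i k) * ind (Nat.ltb k j))) N.
Proof.
intros Hj. unfold signed_min.
destruct (Nat.ltb_spec j i); [|destruct (Nat.ltb_spec i j)].
- rewrite (sum_f_R0_single _ j) by
    (lia || (intros k Hk; destruct (Nat.eqb_spec j k), (Nat.eqb_spec i k),
       (Nat.ltb_spec k j); simpl; try lia; ring)).
  rewrite Nat.eqb_refl. destruct (Nat.ltb_spec j i), (Nat.eqb_spec i j); try lia.
  simpl. ring.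
- rewrite (sum_f_R0_single _ i) by
    (lia || (intros k Hk; destruct (Nat.eqb_spec j k), (Nat.eqb_spec i k),
       (Nat.ltb_spec k i); simpl; try lia; ring)).
  rewrite Nat.eqb_refl. destruct (Nat.ltb_spec i j), (Nat.eqb_spec j i); try lia.
  simpl. ring.
- symmetry. assert (i = j) by lia. subst.
  rewrite (sum_f_R0_single _ j); trivial;
    [rewrite Nat.ltb_irrefl; ring|intros k _; ring].
Qed.

(** Sorting by [k = min(A, B)] gives the sum of [l ^ k * (P(B = k) P(A > k) - P(A = k) P(B > k))].
    Expanding both tails by [bexp_ind_lt] over the same range [j < n] yields the double sum and its
    factor [a]. *)
Lemma coef_bexp a l m n : (m <= n)%nat ->
  coef a l m n = bexp a n (fun i => bexp a m (fun j => signed_min l i j)).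
Proof.
intros Hmn.
rewrite (bexp_ext a n _ (fun i => sum_f_R0 (fun k =>
  l ^ k * (bmass a (Z.of_nat m) k * ind (Nat.ltb k i)
    - bexp a m (fun j => ind (Nat.ltb k j)) * ind (Nat.eqb i k))) m)).
2: { intros i _.
  rewrite (bexp_ext a m (fun j => signed_min l i j) _
    (fun j Hj => signed_min_sum l i j m Hj)), bexp_sum.
  apply sum_eq. intros k _.
  rewrite bexp_scal, bexp_minus, bexp_scal, <- bexp_ind_eq.
  rewrite (bexp_ext a m _ (fun j => ind (Nat.ltb k i) * ind (Nat.eqb j k))),
    bexp_scal by (intros j _; rewrite Nat.eqb_sym; ring).
  ring. }
rewrite bexp_sum. unfold coef.
(* An inner bound [m] independent of [j] allows the two sums to be exchanged. *)
rewrite (sum_below_ext _ _ (fun j => sum_f_R0 (fun k => l ^ k *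
  (bmass a (Z.of_nat m) k * bmass a (Z.of_nat n - 1 - Z.of_nat j) k
   - bmass a (Z.of_nat n) k * bmass a (Z.of_nat m - 1 - Z.of_nat j) k)) m)).
- rewrite sum_below_sum_f_R0, scal_sum. apply sum_eq. intros k _.
  rewrite bexp_scal, bexp_minus, !bexp_scal, bexp_ind_eq.
  rewrite (bexp_ind_lt a n n), (bexp_ind_lt a m n) by lia.
  rewrite sum_below_scal, sum_below_minus, !sum_below_scal. ring.
- intros j Hj.
  rewrite <- (sum_f_R0_extend _ (Nat.min m (n - 1 - j)) m).
  + apply sum_eq. intros k Hk. unfold bmass.
    replace (Z.of_nat n - 1 - Z.of_nat j)%Z with (Z.of_nat (n - 1 - j)) by lia.
    rewrite !Nat2Z.id.
    rewrite (Rmult_minus_distr_r _ _ ((a ^ 2 * l) ^ k)),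
      (Rmult_minus_distr_r _ _ ((1 - a) ^ _)), (Rmult_minus_distr_l (l ^ k)).
    rewrite Rpow_mult_distr, <- pow_mult. f_equal.
    * replace (n + m - 1 - j - 2 * k)%nat with ((m - k) + (n - 1 - j - k))%nat by lia.
      rewrite pow_add. replace (2 * k)%nat with (k + k)%nat by lia.
      rewrite pow_add. ring.
    (* The exponent of [1 - a] splits into two failure counts only when [k <= m - 1 - j]; otherwise
       the binomial is zero. *)
    * destruct (Z_lt_le_dec (Z.of_nat m - 1 - Z.of_nat j) (Z.of_nat k)) as [H|H].
      { rewrite (binom_out _ _ H). ring. }
      replace (n + m - 1 - j - 2 * k)%nat with
        ((n - k) + (Z.to_nat (Z.of_nat m - 1 - Z.of_nat j) - k))%nat by lia.
      rewrite pow_add. replace (2 * k)%nat with (k + k)%nat by lia.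
      rewrite pow_add. ring.
  + lia.
  (* Here [k <= m] forces [k > n - 1 - j >= m - 1 - j], so both products vanish. *)
  + intros k Hk. unfold bmass.
    rewrite (binom_out (Z.of_nat n - 1 - Z.of_nat j)),
      (binom_out (Z.of_nat m - 1 - Z.of_nat j)) by lia. ring.
Qed.

(** * Sine integrals against the Poisson denominator *)

Ltac real_eq :=
  unfold scal, minus, plus, opp; cbn -[INR pow]; unfold mult; cbn -[INR pow];
  match goal with |- @eq _ ?x ?y => change (@eq R x y) end.

(** The squared modulus of [1 - s * cis t], equal to [(1 - s) ^ 2 + 2 * s * (1 - cos t)]. *)
Definition poisson_den (s t : R) : R := 1 - 2 * s * cos t + s ^ 2.

Lemma poisson_den_pos s t : 0 < s -> 0 < t < PI -> 0 < poisson_den s t.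
Proof.
intros Hs Ht. unfold poisson_den.
assert (cos t < 1) by (rewrite <- cos_0; apply cos_decreasing_1; lra).
assert (0 < s * (1 - cos t)) by (apply Rmult_lt_0_compat; lra).
pose proof (pow2_ge_0 (1 - s)). nra.
Qed.

Lemma poisson_den_lower s t : 0 < s -> (1 - s) ^ 2 <= poisson_den s t.
Proof. intros Hs. unfold poisson_den. pose proof (COS_bound t). nra. Qed.

(** Orthogonality of sines. The product-to-sum antiderivative divides by [p - 1], hence the separate
    case [p = 1]. *)
Lemma is_RInt_sin_sin (p : nat) :
  is_RInt (fun t => sin (INR p * t) * sin t) 0 PI
    (if Nat.eqb p 1 then PI / 2 else 0).
Proof.
assert (HS : forall k : Z, sin (IZR k * PI) = 0).
{ intros k. apply sin_eq_0_1. now exists k. }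
destruct (Nat.eqb_spec p 1) as [->|Hp].
- evar_last.
  + apply (is_RInt_derive (fun t => (t - sin t * cos t) / 2)); intros t _.
    * auto_derive; trivial. simpl INR. rewrite !Rmult_1_l.
      pose proof (sin2_cos2 t) as E. unfold Rsqr in E. lra.
    * apply (ex_derive_continuous (V := R_NormedModule)). auto_derive; trivial.
  + real_eq. rewrite sin_PI, sin_0. field.
- assert (H1 : INR p - 1 <> 0).
  { intros H. apply Hp, INR_eq. simpl. lra. }
  assert (H2 : INR p + 1 <> 0) by (pose proof (pos_INR p); lra).
  evar_last.
  + apply (is_RInt_derive (fun t => sin ((INR p - 1) * t) / (2 * (INR p - 1))
      - sin ((INR p + 1) * t) / (2 * (INR p + 1)))); intros t _.
    * auto_derive; trivial.
      replace ((INR p - 1) * t) with (INR p * t - t) by ring.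
      replace ((INR p + 1) * t) with (INR p * t + t) by ring.
      rewrite cos_minus, cos_plus. field. split; trivial.
    * apply (ex_derive_continuous (V := R_NormedModule)). auto_derive; trivial.
  + real_eq.
    rewrite !Rmult_0_r, sin_0, INR_IZR_INZ, <- minus_IZR, <- plus_IZR, !HS.
    rewrite minus_IZR, plus_IZR, <- INR_IZR_INZ. field. split; trivial.
Qed.

Lemma sin_step (p : nat) t :
  sin (INR (S (S p)) * t) = 2 * cos t * sin (INR (S p) * t) - sin (INR p * t).
Proof.
rewrite !S_INR.
replace ((INR p + 1 + 1) * t) with ((INR p + 1) * t + t) by ring.
replace (sin (INR p * t)) with (sin ((INR p + 1) * t - t)) by (f_equal; ring).
rewrite sin_plus, sin_minus. ring.
Qed.

(* For [s < 1] let [d N] be the integral of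
   [(sin ((N + 1) t) - s sin (N t)) sin t] over the denominator.  Then
   [d 0 - PI / 2 = s ^ N * d N] for [N > 0], and [d] is bounded. *)
Lemma is_RInt_poisson_1 s : 0 < s <= 1 ->
  is_RInt (fun t => sin t * sin t / poisson_den s t) 0 PI (PI / 2).
Proof.
intros Hs.
assert (HPI := PI_RGT_0).
destruct (Req_dec s 1) as [->|Hs1].
(* For [s = 1] the denominator is [2 * (1 - cos t)], which cancels against
   [sin t ^ 2 = (1 - cos t) * (1 + cos t)]. *)
{ apply (is_RInt_ext (fun t => (1 + cos t) / 2)).
  - rewrite Rmin_left, Rmax_right by lra. intros t Ht.
    pose proof (poisson_den_pos 1 t) as Hd.
    pose proof (sin2_cos2 t) as E. unfold Rsqr in E.
    unfold poisson_den in *.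
    replace (sin t * sin t) with ((1 + cos t) / 2 * (1 - 2 * 1 * cos t + 1 ^ 2))
      by lra. real_eq. field. lra.
  - evar_last.
    + apply (is_RInt_derive (fun t => (t + sin t) / 2)); intros t _.
      * auto_derive; trivial. lra.
      * apply (ex_derive_continuous (V := R_NormedModule)). auto_derive; trivial.
    + real_eq. rewrite sin_PI, sin_0. field. }
assert (Hd : forall t, 0 < poisson_den s t).
{ intros t. apply Rlt_le_trans with (2 := poisson_den_lower s t (proj1 Hs)).
  apply pow_lt; lra. }
set (f N t := (sin (INR (S N) * t) - s * sin (INR N * t)) * sin t / poisson_den s t).
assert (Hex : ex_RInt (fun t => sin t * sin t / poisson_den s t) 0 PI).
{ apply (ex_RInt_continuous (V := R_CompleteNormedModule)). intros t _.
  apply (ex_derive_continuous (V := R_NormedModule)).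
  specialize (Hd t). unfold poisson_den in *. auto_derive. lra. }
destruct Hex as [I HI].
assert (Hf : forall N, is_RInt (f (S N)) 0 PI ((I - PI / 2) / s ^ S N)).
(* By [sin_step], [f N t - sin ((N + 1) t) * sin t = s * f (S N) t]; by orthogonality the subtracted
   term contributes only at [N = 0]. *)
{ assert (step : forall N d, is_RInt (f N) 0 PI d -> is_RInt (f (S N)) 0 PI
    ((d - (if Nat.eqb (S N) 1 then PI / 2 else 0)) / s)).
  { intros N d H.
    apply (is_RInt_ext (fun t => scal (/ s)
      (minus (f N t) (sin (INR (S N) * t) * sin t)))).
    - intros t _. unfold f. real_eq.
      rewrite sin_step. specialize (Hd t). unfold poisson_den in *. field. lra.
    - replace ((d - (if Nat.eqb (S N) 1 then PI / 2 else 0)) / s)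
        with (scal (/ s) (minus d (if Nat.eqb (S N) 1 then PI / 2 else 0))).
      + apply @is_RInt_scal, @is_RInt_minus; trivial. apply is_RInt_sin_sin.
      + real_eq. field. lra. }
  induction N as [|N IH].
  - rewrite pow_1. apply (step O).
    apply is_RInt_ext with (2 := HI). intros t _. unfold f. simpl INR.
    rewrite Rmult_0_l, sin_0, Rmult_1_l. f_equal. ring.
  - apply step in IH. simpl Nat.eqb in IH. evar_last; [exact IH|].
    simpl. field. split; [|lra].
    apply pow_nonzero; lra. }
assert (E : I = PI / 2); [|now rewrite <- E].
(* Interval length times a bound on [f]: the sines give at most [1 + s <= 2], and the denominator is
   at least [(1 - s) ^ 2]. *)
set (M := PI * (2 / (1 - s) ^ 2)).
assert (HM : 0 < M).
{ apply Rmult_lt_0_compat; trivial. apply Rdiv_lt_0_compat; [lra|].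
  apply pow_lt; lra. }
assert (Hb : forall N, Rabs (I - PI / 2) <= s ^ S N * M).
{ intros N.
  assert (Hp : 0 < s ^ S N) by (apply pow_lt; lra).
  assert (H : Rabs ((I - PI / 2) / s ^ S N) <= (PI - 0) * (2 / (1 - s) ^ 2)).
  { apply (norm_RInt_le_const (V := R_NormedModule) (f (S N))); [lra| |apply Hf].
    intros t _. change (Rabs (f (S N) t) <= 2 / (1 - s) ^ 2). unfold f.
    rewrite Rabs_div by (specialize (Hd t); lra).
    rewrite (Rabs_right (poisson_den s t)) by (specialize (Hd t); lra).
    apply Rmult_le_compat.
    - apply Rabs_pos.
    - left. now apply Rinv_0_lt_compat.
    - pose proof (SIN_bound (INR (S (S N)) * t)).
      pose proof (SIN_bound (INR (S N) * t)).
      pose proof (SIN_bound t).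
      rewrite Rabs_mult. replace 2 with (2 * 1) by ring.
      apply Rmult_le_compat; try apply Rabs_pos; apply Rabs_le; nra.
    - apply Rinv_le_contravar; [apply pow_lt; lra|].
      apply poisson_den_lower; lra. }
  rewrite Rabs_div, (Rabs_right (s ^ S N)) in H by lra.
  unfold M. rewrite Rminus_0_r in H.
  apply (Rmult_le_compat_l (s ^ S N)) in H; [|lra].
  replace (s ^ S N * (Rabs (I - PI / 2) / s ^ S N)) with (Rabs (I - PI / 2)) in H
    by (field; lra).
  exact H. }
destruct (Req_dec I (PI / 2)) as [|Hne]; trivial. exfalso.
assert (Hpos : 0 < Rabs (I - PI / 2)) by (apply Rabs_pos_lt; lra).
destruct (pow_lt_1_zero s ltac:(rewrite Rabs_right; lra)
  (Rabs (I - PI / 2) / M) (Rdiv_lt_0_compat _ _ Hpos HM)) as [N HN].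
specialize (HN (S N) ltac:(lia)). specialize (Hb N).
rewrite Rabs_right in HN by (left; apply pow_lt; lra).
apply (Rmult_lt_compat_r M) in HN; trivial.
replace (Rabs (I - PI / 2) / M * M) with (Rabs (I - PI / 2)) in HN by (field; lra).
lra.
Qed.

(** Since [2 * s * cos t = 1 + s ^ 2 - poisson_den s t], the recurrence [sin_step] gives [s * (K (p
    + 2) + K p) = (1 + s ^ 2) * K (p + 1) - sin ((p + 1) t) * sin t]; hence the induction on two
    consecutive values. *)
Lemma is_RInt_poisson s (p : nat) : 0 < s <= 1 ->
  is_RInt (fun t => sin (INR p * t) * sin t / poisson_den s t) 0 PI
    (if Nat.eqb p 0 then 0 else PI / 2 * s ^ (p - 1)).
Proof.
intros Hs. assert (HPI := PI_RGT_0).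
set (K p t := sin (INR p * t) * sin t / poisson_den s t).
set (v p := if Nat.eqb p 0 then 0 else PI / 2 * s ^ (p - 1)).
change (is_RInt (K p) 0 PI (v p)).
enough (H : is_RInt (K p) 0 PI (v p) /\ is_RInt (K (S p)) 0 PI (v (S p)))
  by apply H.
induction p as [|p [IH0 IH1]].
- split.
  + apply (is_RInt_ext (fun _ => 0)).
    * intros t _. unfold K. simpl. rewrite Rmult_0_l, sin_0. unfold Rdiv; ring.
    * evar_last; [apply @is_RInt_const|].
      unfold v. real_eq. ring.
  + apply (is_RInt_ext (fun t => sin t * sin t / poisson_den s t)).
    * intros t _. unfold K. simpl INR. now rewrite Rmult_1_l.
    * unfold v; simpl. rewrite Rmult_1_r. now apply is_RInt_poisson_1.
- split; trivial.
  apply (is_RInt_ext (fun t => minus (scal (/ s)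
    (minus (scal (1 + s ^ 2) (K (S p) t)) (sin (INR (S p) * t) * sin t))) (K p t))).
  + rewrite Rmin_left, Rmax_right by lra. intros t Ht.
    real_eq. unfold K.
    rewrite sin_step. pose proof (poisson_den_pos s t (proj1 Hs) Ht) as Hd.
    unfold poisson_den in *. field. lra.
  + evar_last.
    * apply @is_RInt_minus; [apply @is_RInt_scal, @is_RInt_minus|exact IH0];
        [apply @is_RInt_scal, IH1|apply is_RInt_sin_sin].
    * unfold v. real_eq.
      destruct p as [|p]; simpl; [|rewrite Nat.sub_0_r]; field; lra.
Qed.

(** * From the Riemann integral to the improper one *)

Lemma is_RInt_gen_at_right (f : R -> R) a b J : a < b ->
  is_RInt f a b J -> is_RInt_gen f (at_right a) (at_point b) J.
Proof.
intros Hab HJ.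
(* Extended by 0 to the left of a, the function is integrable on both sides
   of a, so that its integral is continuous at a. *)
set (g x := if Rle_dec x a then 0 else f x).
set (F z := RInt g z b).
assert (Hg : is_RInt g a b J).
{ apply is_RInt_ext with (2 := HJ). intros x Hx.
  rewrite Rmin_left in Hx by lra. unfold g. destruct (Rle_dec x a); lra. }
assert (HF : forall z, z < b -> is_RInt g z b (F z)).
{ intros z Hz. apply (RInt_correct (V := R_CompleteNormedModule)).
  destruct (Rle_dec a z).
  - apply (ex_RInt_Chasles_2 (V := R_CompleteNormedModule) g a); [lra|].
    now exists J.
  - apply ex_RInt_Chasles with a; [|now exists J].
    apply (ex_RInt_ext (fun _ => 0)); [|apply ex_RInt_const].
    intros x Hx. rewrite Rmax_right in Hx by lra. unfold g.
    destruct (Rle_dec x a); lra. }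
assert (HC : continuous F a).
{ apply (continuous_RInt_2 g a b F).
  apply (filter_imp (fun z => z < b)); [exact HF|].
  now apply open_lt. }
assert (EF : F a = J) by (apply is_RInt_unique, Hg).
unfold is_RInt_gen.
apply (filterlimi_lim_ext_loc (fun ab : R * R => F (fst ab))).
- apply Filter_prod with (fun x => a < x < b) (fun y => y = b).
  + unfold at_right, within. apply (filter_imp (fun z => z < b)).
    * intros z Hz Ha. lra.
    * now apply open_lt.
  + reflexivity.
  + intros x y Hx ->. simpl. apply is_RInt_ext with (2 := HF x (proj2 Hx)).
    intros t Ht. rewrite Rmin_left in Ht by lra. unfold g.
    destruct (Rle_dec t a); lra.
- rewrite <- EF. apply filterlim_comp with (at_right a).
  + apply filterlim_fst.
  + apply filterlim_filter_le_1 with (2 := HC). apply filter_le_within.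
Qed.

(** * Polar form and expansion of the integrand *)

Lemma cis_add x y : (cis x * cis y)%C = cis (x + y).
Proof.
unfold cis, Cmult; simpl. rewrite cos_plus, sin_plus. f_equal; ring.
Qed.

Lemma cis_pow t n : (cis t ^ n)%C = cis (INR n * t).
Proof.
induction n as [|n IH].
- simpl. unfold cis. now rewrite Rmult_0_l, cos_0, sin_0.
- rewrite Cpow_S, IH, cis_add, S_INR. f_equal. ring.
Qed.

(** De Moivre's formula, used in both directions: with the modulus and argument of [z_] to recognise
    the integrand, and with [s] and [t] to evaluate the expanded terms. *)
Lemma Im_polar r t n m :
  Im ((RtoC r * cis t) ^ n * (RtoC r * cis (- t)) ^ m)%C
  = r ^ (n + m) * sin ((INR n - INR m) * t).
Proof.
rewrite !Cpow_mult_l, !cis_pow, <- !RtoC_pow.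
replace (RtoC (r ^ n) * cis (INR n * t) * (RtoC (r ^ m) * cis (INR m * - t)))%C
  with (RtoC (r ^ (n + m)) * cis (INR n * t + INR m * - t))%C.
- rewrite im_scal_l. unfold cis; simpl. do 2 f_equal. ring.
- rewrite <- cis_add, pow_add, RtoC_mult. ring.
Qed.

Lemma Cconj_cis t : Cconj (cis t) = cis (- t).
Proof. unfold cis, Cconj; simpl. now rewrite cos_neg, sin_neg. Qed.

Lemma integrand_bexp a s m n t : 0 < a -> 0 < s -> 0 < t < PI ->
  integrand a s m n t
  = bexp a n (fun i => bexp a m (fun j =>
      s ^ (i + j) * sin ((INR i - INR j) * t) * sin t / poisson_den s t)).
Proof.
intros Ha Hs Ht. unfold integrand, r_, phi_.
destruct (Req_dec_T t PI); [lra|].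
(* The imaginary part [a * s * sin t] is positive inside the interval, so [Carg] is a genuine
   argument. *)
assert (Hz : z_ a s t <> 0%C).
{ intros H. apply (f_equal Im) in H. unfold z_ in H.
  rewrite im_plus, im_scal_l in H.
  unfold cis in H; simpl in H.
  assert (0 < a * s * sin t) by
    (repeat apply Rmult_lt_0_compat; trivial; now apply sin_gt_0).
  lra. }
destruct (Carg_correct _ Hz) as [_ E].
assert (E' : Cconj (z_ a s t)
  = (RtoC (Cmod (z_ a s t)) * cis (- Carg (z_ a s t)))%C).
{ rewrite E at 1. rewrite Cmult_conj, Cconj_cis. f_equal.
  unfold Cconj; simpl. unfold RtoC. f_equal. ring. }
rewrite (Nat.add_comm m n), <- Im_polar, <- E, <- E'.
set (x := (RtoC s * cis t)%C).
assert (Ez : z_ a s t = (RtoC (1 - a) + RtoC a * x)%C).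
{ unfold z_, x. rewrite RtoC_mult. ring. }
assert (Ez' : Cconj (z_ a s t) = (RtoC (1 - a) + RtoC a * Cconj x)%C).
{ rewrite Ez, Cplus_conj, Cmult_conj. unfold Cconj at 1 2; simpl.
  unfold RtoC. now rewrite Ropp_0. }
assert (Ex : Cconj x = (RtoC s * cis (- t))%C).
{ unfold x. rewrite Cmult_conj, Cconj_cis. f_equal.
  unfold Cconj; simpl. unfold RtoC. f_equal. ring. }
rewrite Ez', Ez, Im_bexp.
unfold Rdiv. rewrite Rmult_assoc, Rmult_comm, <- bexp_scal.
apply bexp_ext. intros i _.
(* Commuting brings the conjugate power to the front, where the second expansion applies. *)
rewrite Cmult_comm, Im_bexp, <- bexp_scal.
apply bexp_ext. intros j _.
rewrite Cmult_comm, Ex. unfold x. rewrite Im_polar.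
unfold poisson_den. ring.
Qed.

(** The value is [PI / (2 * s)] times [sgn(i - j) * (s ^ 2) ^ max(i, j)], written through
    [signed_min] so that [coef] appears after taking expectations. *)
Lemma is_RInt_poisson_diff s (i j : nat) : 0 < s <= 1 ->
  is_RInt (fun t => s ^ (i + j) * sin ((INR i - INR j) * t) * sin t
    / poisson_den s t) 0 PI
    (PI / (2 * s) * (signed_min (s ^ 2) i j - ((s ^ 2) ^ j - (s ^ 2) ^ i))).
Proof.
intros Hs.
assert (Hlt : forall i j, (j <= i)%nat ->
  is_RInt (fun t => s ^ (i + j) * sin ((INR i - INR j) * t) * sin t
    / poisson_den s t) 0 PI
    (if Nat.eqb (i - j) 0 then 0 else PI / (2 * s) * (s ^ 2) ^ i)).
{ clear i j; intros i j Hij.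
  apply (is_RInt_ext (fun t => scal (s ^ (i + j))
    (sin (INR (i - j) * t) * sin t / poisson_den s t))).
  - intros t _. rewrite minus_INR by trivial. real_eq. unfold Rdiv. ring.
  - evar_last; [apply @is_RInt_scal, is_RInt_poisson, Hs|].
    destruct (Nat.eqb_spec (i - j) 0); real_eq; [ring|].
    rewrite <- pow_mult.
    (* The prefactor and the Poisson integral together carry the exponent
       [(i + j) + (i - j - 1) = 2 * i - 1]. *)
    replace (2 * i)%nat with (S ((i + j) + (i - j - 1))) by lia.
    rewrite <- tech_pow_Rmult, (pow_add s (i + j)). field. lra. }
unfold signed_min.
destruct (Nat.ltb_spec j i) as [H|H]; [|destruct (Nat.ltb_spec i j) as [H'|H']].
- evar_last; [apply Hlt; lia|].
  destruct (Nat.eqb_spec (i - j) 0); [lia|]. real_eq. field. lra.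
- apply (is_RInt_ext (fun t => opp (s ^ (j + i) * sin ((INR j - INR i) * t)
    * sin t / poisson_den s t))).
  + intros t _. real_eq. rewrite (Nat.add_comm j i).
    replace ((INR j - INR i) * t) with (- ((INR i - INR j) * t)) by ring.
    rewrite sin_neg. unfold Rdiv. ring.
  + evar_last; [apply @is_RInt_opp, Hlt; lia|].
    destruct (Nat.eqb_spec (j - i) 0); [lia|]. real_eq. field. lra.
- assert (i = j) by lia. subst. evar_last; [apply Hlt; lia|].
  rewrite Nat.sub_diag. real_eq. ring.
Qed.

Theorem proposition8 (ell alpha : R) (Hell : 0 < ell <= 1)
    (Halpha : 0 < alpha <= 1) (m n : nat) (Hmn : (m <= n)%nat) :
  let sigma := sqrt ell in
  let ell_alpha := 1 - alpha + alpha * ell in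
  exists J : R,
    is_integral_0_PI ell (integrand alpha sigma m n) J /\
    coef alpha ell m n
    = ell_alpha ^ m - ell_alpha ^ n + 2 * sigma / PI * J.
Proof.
intros s ella.
assert (HPI := PI_RGT_0).
assert (Hs0 : 0 < s) by (apply sqrt_lt_R0; lra).
assert (Hs2 : s ^ 2 = ell) by (apply pow2_sqrt; lra).
assert (Hs1 : s <= 1) by nra.
set (J := bexp alpha n (fun i => bexp alpha m (fun j =>
  PI / (2 * s) * (signed_min (s ^ 2) i j - ((s ^ 2) ^ j - (s ^ 2) ^ i))))).
assert (HJ : is_RInt (integrand alpha s m n) 0 PI J).
{ apply is_RInt_ext with (2 := is_RInt_bexp _ _ _ _ _ _ (fun i =>
    is_RInt_bexp alpha m _ _ _ _ (fun j =>
    is_RInt_poisson_diff s i j (conj Hs0 Hs1)))).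
  rewrite Rmin_left, Rmax_right by lra. intros t Ht. simpl.
  symmetry. apply integrand_bexp; lra. }
exists J. split.
(* The Riemann integral exists even for [ell = 1], where the improper one takes the same value. *)
- split; intros _; [exact HJ|]. now apply is_RInt_gen_at_right.
- rewrite coef_bexp by trivial.
  assert (EJ : J = PI / (2 * s) *
    (bexp alpha n (fun i => bexp alpha m (fun j => signed_min ell i j))
     - (ella ^ m - ella ^ n))).
  { unfold J, ella. rewrite Hs2, <- !bexp_pow.
    (* [ella ^ m] involves only the inner variable; a constant outer expectation is inserted to
       combine all terms under one double expectation. *)
    rewrite <- (bexp_const alpha n (bexp alpha m (pow ell))), <- !bexp_minus.
    rewrite <- bexp_scal. apply bexp_ext. intros i _.
    rewrite bexp_scal, !bexp_minus, bexp_const. reflexivity. }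
  rewrite EJ. field. lra.
Qed.
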